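(* Let $(G_1,G_2)$ be a composable pair, and let $G$ be the split graph unification of $(G_1,G_2)$. Then: (i) if $G_1$ and $G_2$ are $P_5$-free, then $G$ is $P_5$-free; (ii) if $G_1$ and $G_2$ are $\overline{P_5}$-free, then $G$ is $\overline{P_5}$-free; (iii) if $G_1$ and $G_2$ are $C_5$-free, then $G$ is $C_5$-free.
   Context: All graphs are finite and simple. $\overline{G}$ is the complement of $G$, $G[X]$ is the subgraph of $G$ induced by $X$, and $G\smallsetminus v$ is $G$ with the vertex $v$ deleted. $P_5$ is the path on five vertices and $C_5$ the cycle on five vertices. $G$ is $H$-free if no induced subgraph of $G$ is isomorphic to $H$. A vertex $v\notin X$ is complete (anti-complete) to $X$ if it is adjacent (non-adjacent) to every vertex of $X$; disjoint sets $A,B$ are complete (anti-complete) to each other if every vertex of $A$ is complete (anti-complete) to $B$. Split graph unification: let $A,B,C,L,T$ be pairwise disjoint sets with $A$ and $C$ non-empty, and let $a,c$ be distinct vertices not in $A\cup B\cup C\cup L\cup T$. Let $G_1$ be a graph with vertex-set $A\cup L\cup T\cup\{c\}$ in which $L$ is a (possibly empty) clique, $T$ is a (possibly empty) stable set, $A$ is anti-complete to $T$, and $c$ is complete to $L$ and anti-complete to $A\cup T$. Let $G_2$ be a graph with vertex-set $B\cup C\cup L\cup T\cup\{a\}$ in which $G_2[L\cup T]=G_1[L\cup T]$, $T$ is anti-complete to $C$, $L$ is complete to $B\cup C$, and $a$ is complete to $B$ and anti-complete to $C\cup L\cup T$. Then $(G_1,G_2)$ is called a composable pair, and its split graph unification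 is the graph $G$ with vertex-set $A\cup B\cup C\cup L\cup T$ such that $G[A\cup L\cup T]=G_1\smallsetminus c$, $G[B\cup C\cup L\cup T]=G_2\smallsetminus a$, and $A$ is complete to $B$ and anti-complete to $C$ in $G$. *)

(* Defs.v *)
From mathcomp Require Import all_boot.

Set Implicit Arguments.
Unset Strict Implicit.
Unset Printing Implicit Defensive.

(* A finite simple graph with vertices drawn from an ambient finite type T.
   The vertex set is a subset of T, so that two graphs may share some of their
   vertices; edges are 2-element sets of vertices, so that equality of graphs
   is Leibniz equality (see sgraph_eq). *)
Record sgraph (T : finType) := SGraph {
  vertices : {set T};
  edges : {set {set T}};
  edgesP : [forall e in edges, (e \subset vertices) && (#|e| == 2)]
}.

Lemma sgraph_eq (T : finType) (G H : sgraph T) :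
  vertices G = vertices H -> edges G = edges H -> G = H.
Proof.
case: G H => [VG EG pG] [VH EH pH] /= eV eE.
by case: _ / eV in pH *; case: _ / eE in pH *; rewrite (bool_irrelevance pG pH).
Qed.

Definition adj (T : finType) (G : sgraph T) : rel T :=
  fun x y => [set x; y] \in edges G.

Fact complement_proof (T : finType) (G : sgraph T) :
  [forall e in [set e : {set T} |
      [&& e \subset vertices G, #|e| == 2 & e \notin edges G]],
    (e \subset vertices G) && (#|e| == 2)].
Proof. by apply/forall_inP=> e; rewrite inE => /and3P[-> ->]. Qed.

Definition complement (T : finType) (G : sgraph T) : sgraph T :=
  SGraph (complement_proof G).

Fact induced_proof (T : finType) (G : sgraph T) (X : {set T}) :
  [forall e in [set e in edges G | e \subset X],
    (e \subset vertices G :&: X) && (#|e| == 2)].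
Proof.
apply/forall_inP=> e; rewrite inE subsetI => /andP[eG ->].
by rewrite andbT (forall_inP (edgesP G)).
Qed.

(* G[X]; vertices of X outside G are ignored. *)
Definition induced (T : finType) (G : sgraph T) (X : {set T}) : sgraph T :=
  SGraph (induced_proof G X).

Definition delete (T : finType) (G : sgraph T) (v : T) : sgraph T :=
  induced G (vertices G :\ v).

Definition isomorphic (T U : finType) (G : sgraph T) (H : sgraph U) : Prop :=
  exists f : T -> U,
    [/\ {in vertices G &, injective f},
        f @: vertices G = vertices H
      & {in vertices G &, forall x y, adj H (f x) (f y) = adj G x y}].

Definition free (T U : finType) (H : sgraph U) (G : sgraph T) : Prop :=
  forall X : {set T}, X \subset vertices G -> ~ isomorphic (induced G X) H.

Fact graph_of_proof (T : finType) (r : rel T) :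
  [forall e in [set [set p.1; p.2] | p : T * T & (p.1 != p.2) && r p.1 p.2],
    (e \subset [set: T]) && (#|e| == 2)].
Proof.
apply/forall_inP=> e /imsetP[p]; rewrite inE => /andP[ne _] ->.
by rewrite subsetT cards2 ne.
Qed.

Definition graph_of (T : finType) (r : rel T) : sgraph T :=
  SGraph (graph_of_proof r).

Lemma graph_of_adj (T : finType) (r : rel T) (x y : T) :
  adj (graph_of r) x y = (x != y) && (r x y || r y x).
Proof.
apply/imsetP/andP => [[[u v]] | [ne /orP[rxy|ryx]]].
- rewrite inE /= => /andP[ne ruv] e.
  have nxy : x != y by have := cards2 x y; rewrite e cards2 ne; case: (x != y).
  have /set2P xE : x \in [set u; v] by rewrite -e set21.
  have /set2P yE : y \in [set u; v] by rewrite -e set22.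
  split=> //; move: nxy ruv.
  by case: xE yE => -> [] ->; rewrite ?eqxx // => _ ->; rewrite ?orbT.
- by exists (x, y); rewrite ?inE /= ?ne.
- by exists (y, x); rewrite ?inE /= ?[y == x]eq_sym ?ne // setUC.
Qed.

Definition P5 : sgraph 'I_5 := graph_of (fun i j : 'I_5 => j == i.+1 :> nat).

Definition C5 : sgraph 'I_5 :=
  graph_of (fun i j : 'I_5 => j == i.+1 %% 5 :> nat).

Definition clique (T : finType) (G : sgraph T) (X : {set T}) : Prop :=
  {in X &, forall x y, x != y -> adj G x y}.

Definition stable (T : finType) (G : sgraph T) (X : {set T}) : Prop :=
  {in X &, forall x y, ~~ adj G x y}.

Definition vcomplete (T : finType) (G : sgraph T) (v : T) (X : {set T}) : Prop :=
  v \notin X /\ {in X, forall x, adj G v x}.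

Definition vanticomplete (T : finType) (G : sgraph T) (v : T) (X : {set T}) :
    Prop :=
  v \notin X /\ {in X, forall x, ~~ adj G v x}.

Definition complete (T : finType) (G : sgraph T) (X Y : {set T}) : Prop :=
  {in X, forall x, vcomplete G x Y}.

Definition anticomplete (T : finType) (G : sgraph T) (X Y : {set T}) : Prop :=
  {in X, forall x, vanticomplete G x Y}.

Record composable (V : finType) (A B C L T : {set V}) (a c : V)
    (G1 G2 : sgraph V) : Prop := Composable {
  comp_disjoint : pairwise (fun X Y : {set V} => [disjoint X & Y])
                    [:: A; B; C; L; T];
  comp_A : A != set0;
  comp_C : C != set0;
  comp_ac : a != c;
  comp_a : a \notin A :|: B :|: C :|: L :|: T;
  comp_c : c \notin A :|: B :|: C :|: L :|: T;
  comp_V1 : vertices G1 = A :|: L :|: T :|: [set c];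
  comp_L : clique G1 L;
  comp_T : stable G1 T;
  comp_AT : anticomplete G1 A T;
  comp_cL : vcomplete G1 c L;
  comp_cAT : vanticomplete G1 c (A :|: T);
  comp_V2 : vertices G2 = B :|: C :|: L :|: T :|: [set a];
  comp_LT : induced G2 (L :|: T) = induced G1 (L :|: T);
  comp_TC : anticomplete G2 T C;
  comp_LBC : complete G2 L (B :|: C);
  comp_aB : vcomplete G2 a B;
  comp_aCLT : vanticomplete G2 a (C :|: L :|: T)
}.

(* These conditions determine G uniquely from a composable pair. *)
Record split_graph_unification (V : finType) (A B C L T : {set V}) (a c : V)
    (G1 G2 G : sgraph V) : Prop := SplitGraphUnification {
  unif_V : vertices G = A :|: B :|: C :|: L :|: T;
  unif_1 : induced G (A :|: L :|: T) = delete G1 c;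
  unif_2 : induced G (B :|: C :|: L :|: T) = delete G2 a;
  unif_AB : complete G A B;
  unif_AC : anticomplete G A C
}.

(* Main.v *)
Require Import Defs.
From mathcomp Require Import all_boot.

(** Sort the five vertices of a copy of [H] in [G] by the parts [A], [B], [C],
    [L], [T] containing them.  If at most one of them lies in [B :|: C], and
    that one has no neighbour among those in [A :|: T], then replacing it by
    [c] yields a copy of [H] in [G1].  If at most one of them lies in [A], and
    that one has no neighbour among those in [L], then replacing it by [a]
    yields a copy of [H] in [G2].  For [P5], its complement and [C5], every
    distribution of the five vertices that respects the adjacencies prescribed
    between the parts is of one of these two kinds; this is a finite check. *)

Set Implicit Arguments.
Unset Strict Implicit.
Unset Printing Implicit Defensive.

(** * Adjacency in induced subgraphs and complements *)

Lemma adjC (V : finType) (G : sgraph V) x y : adj G x y = adj G y x.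
Proof. by rewrite /adj setUC. Qed.

Lemma adjxx (V : finType) (G : sgraph V) x : adj G x x = false.
Proof.
apply/negP=> /(forall_inP (edgesP G))/andP[_].
by rewrite setUid cards1.
Qed.

Lemma adj_induced (V : finType) (G : sgraph V) (X : {set V}) x y :
  adj (induced G X) x y = [&& adj G x y, x \in X & y \in X].
Proof. by rewrite /adj inE subUset !sub1set. Qed.

Lemma adj_complement (V : finType) (G : sgraph V) x y :
  adj (complement G) x y =
  [&& x \in vertices G, y \in vertices G, x != y & ~~ adj G x y].
Proof.
rewrite /adj inE subUset !sub1set cards2 -andbA.
by case: (x == y).
Qed.

(** * Induced copies as maps, and the replacement of one vertex *)

(** An induced copy given as a map out of [H], so that exchanging one vertex of the copy is a
    pointwise change. *)
Definition embedding (U V : finType) (H : sgraph U) (G : sgraph V)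
    (f : U -> V) : Prop :=
  [/\ injective f, forall u, f u \in vertices G
    & forall u v, adj G (f u) (f v) = adj H u v].

Lemma free_no_embedding (U V : finType) (H : sgraph U) (G : sgraph V)
    (f : U -> V) (u0 : U) :
  vertices H = [set: U] -> free H G -> ~ embedding H G f.
Proof.
move=> HT HG [finj fG fadj].
have sub : f @: [set: U] \subset vertices G.
  by apply/subsetP=> _ /imsetP[u _ ->].
apply: (HG _ sub).
(* A left inverse of [f]; [u0] is only the default value off the image. *)
pose g x := odflt u0 [pick u | f u == x].
have fK : cancel f g.
  move=> u; rewrite /g; case: pickP => [v /eqP/finj//|/(_ u)].
  by rewrite eqxx.
have VX x : x \in vertices (induced G (f @: [set: U])) -> exists u, x = f u.
  by rewrite inE => /andP[_ /imsetP[u _ ->]]; exists u.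
exists g; split.
- by move=> x y /VX[u ->] /VX[v ->]; rewrite !fK => ->.
- rewrite HT; apply/setP=> u; rewrite inE; apply/imsetP; exists (f u).
    by rewrite inE fG imset_f.
  by rewrite fK.
- move=> x y /VX[u ->] /VX[v ->].
  by rewrite !fK adj_induced fadj !imset_f ?andbT.
Qed.

Lemma no_embedding_free (U V : finType) (H : sgraph U) (G : sgraph V) :
  vertices H = [set: U] -> (forall f, ~ embedding H G f) -> free H G.
Proof.
move=> HT noemb X XG [g [ginj gim gadj]].
have VX : vertices (induced G X) = X by apply/setIidPr.
rewrite VX HT in ginj gim gadj.
(* The isomorphism [g] runs from the subgraph to [H]; choosing preimages turns it round. *)
have /fin_all_exists2[f fX fK] u : exists2 x, x \in X & u = g x.
  by apply/imsetP; rewrite gim inE.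
apply: (noemb f); split.
- by move=> u v e; rewrite (fK u) (fK v) e.
- by move=> u; apply: (subsetP XG).
- move=> u v; have := gadj _ _ (fX u) (fX v).
  by rewrite -!fK adj_induced !fX !andbT.
Qed.

(** As [m] holds for at most one index, the only adjacencies that can change are those between [w]
    and the vertices kept. *)
Lemma embedding_replace (U V : finType) (H : sgraph U) (G G' : sgraph V)
    (f : U -> V) (w : V) (m : pred U) :
    embedding H G f -> w \in vertices G' ->
    {in m &, forall i j, i = j} ->
    (forall i, ~~ m i -> f i \in vertices G' /\ f i != w) ->
    (forall i j, ~~ m i -> ~~ m j ->
       adj G' (f i) (f j) = adj G (f i) (f j)) ->
    (forall i j, m i -> ~~ m j -> adj G' w (f j) = adj H i j) ->
  embedding H G' (fun i => if m i then w else f i).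
Proof.
move=> [finj fG fadj] wG' m1 fG' adjG' adjw; split.
- move=> i j; case: ifPn => mi; case: ifPn => mj.
  + by move=> _; apply: m1.
  + by move=> e; have [_] := fG' j mj; rewrite e eqxx.
  + by move=> e; have [_] := fG' i mi; rewrite e eqxx.
  + exact: finj.
- by move=> i; case: ifPn => // /fG'[].
- move=> i j; case: ifPn => mi; case: ifPn => mj.
  + by rewrite (m1 i j) // !adjxx.
  + exact: adjw.
  + by rewrite adjC [RHS]adjC; apply: adjw.
  + by rewrite adjG'.
Qed.

(** * The finite check on distributions among the parts *)

Inductive part := PA | PB | PC | PL | PT.

Definition parts := [:: PA; PB; PC; PL; PT].

(* Whether adjacency [b] is allowed between distinct vertices of the parts [p]
   and [q] of a split graph unification. *)
Definition compatible (p q : part) (b : bool) : bool :=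
  match p, q with
  | PA, PB | PB, PA | PL, PL | PB, PL | PL, PB | PC, PL | PL, PC => b
  | PA, PC | PC, PA | PA, PT | PT, PA | PT, PT | PC, PT | PT, PC => ~~ b
  | _, _ => true
  end.

Definition inBC p := if p is (PB | PC) then true else false.
Definition inAT p := if p is (PA | PT) then true else false.
Definition inA p := if p is PA then true else false.
Definition inL p := if p is PL then true else false.

(** Ranges over numbers instead of ordinals so that the check evaluates by computation. *)
Definition all_pairs n (P : rel nat) : bool :=
  all (fun i => all (P i) (iota 0 n)) (iota 0 n).

Lemma all_pairsP n (P : rel nat) :
  reflect (forall i j : 'I_n, P i j) (all_pairs n P).
Proof.
apply: (iffP allP) => [PP i j | PP i].
  by apply: (allP (PP i _)); rewrite mem_iota ltn_ord.
rewrite mem_iota => /= ltin; apply/allP=> j; rewrite mem_iota => /= ltjn.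
exact: (PP (Ordinal ltin) (Ordinal ltjn)).
Qed.

Definition consistent n (h : rel nat) (s : seq part) : bool :=
  all_pairs n (fun i j =>
    (i != j) ==> compatible (nth PA s i) (nth PA s j) (h i j)).

(** The vertex in a [merged] part is the one to be exchanged. Only its pairs with [barred] parts
    need a condition: towards the other parts, [compatible] already prescribes the adjacencies of
    the new vertex. *)
Definition replaceable n (h : rel nat) (merged barred : pred part)
    (s : seq part) : bool :=
  all_pairs n (fun i j => merged (nth PA s i) ==>
    (merged (nth PA s j) ==> (i == j)) && (barred (nth PA s j) ==> ~~ h i j)).

Fixpoint all_words n (P : pred (seq part)) : bool :=
  if n is n'.+1 then all (fun p => all_words n' (fun s => P (p :: s))) parts
  else P [::].

Lemma all_wordsP n P s : all_words n P -> size s = n -> P s.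
Proof.
elim: n P s => [|n IHn] P [|p s] //= H [sz].
apply: (IHn (fun s => P (p :: s))) => //.
by case/and5P: H => ? ? ? ? /andP[? _]; case: p.
Qed.

Definition splittable n (h : rel nat) : bool :=
  all_words n (fun s => consistent n h s ==>
    replaceable n h inBC inAT s || replaceable n h inA inL s).

Lemma splittableP n (h : rel nat) (l : 'I_n -> part) :
    splittable n h ->
    (forall i j, i != j -> compatible (l i) (l j) (h i j)) ->
  let repl (merged barred : pred part) :=
    (forall i j, merged (l i) -> merged (l j) -> i = j) /\
    (forall i j, merged (l i) -> barred (l j) -> ~~ h i j) in
  repl inBC inAT \/ repl inA inL.
Proof.
(* The labelling [l] becomes the word of its values, one of those enumerated by [all_words]. *)
move=> hS lS repl; pose s := codom l.
have sE (i : 'I_n) : nth PA s i = l i.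
  by rewrite (nth_map i) ?size_enum_ord // nth_ord_enum.
have replP merged barred : replaceable n h merged barred s ->
    repl merged barred.
  move=> /all_pairsP r; split=> i j mi.
    by move=> mj; have := r i j; rewrite !sE mi mj => /andP[/eqP/ord_inj].
  by move=> bj; have := r i j; rewrite !sE mi bj => /andP[].
have cs : consistent n h s.
  by apply/all_pairsP=> i j; rewrite !sE; apply/implyP=> /lS.
have sz : size s = n by rewrite size_codom card_ord.
by have /implyP/(_ cs)/orP[/replP|/replP] := all_wordsP hS sz; [left|right].
Qed.

(** * From a copy in the unification to a copy in one of the two graphs *)

Section Unification.

Variables (V : finType) (A B C L T : {set V}) (a c : V) (G1 G2 G : sgraph V).
Hypothesis hcomp : composable A B C L T a c G1 G2.
Hypothesis hG : split_graph_unification A B C L T a c G1 G2 G.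

Definition part_set (p : part) : {set V} :=
  match p with PA => A | PB => B | PC => C | PL => L | PT => T end.

(** The final default [PT] is right for vertices of [G], which lie in the union of the five sets. *)
Definition part_of (x : V) : part :=
  if x \in A then PA else if x \in B then PB else if x \in C then PC
  else if x \in L then PL else PT.

Lemma part_ofP x : x \in vertices G -> x \in part_set (part_of x).
Proof.
rewrite (unif_V hG) !inE /part_of.
by do 4!case: ifP => //=.
Qed.

Lemma c_notin x : x \in A :|: B :|: C :|: L :|: T -> x != c.
Proof. by move=> xG; apply: contraNneq (comp_c hcomp) => <-. Qed.

Lemma a_notin x : x \in A :|: B :|: C :|: L :|: T -> x != a.
Proof. by move=> xG; apply: contraNneq (comp_a hcomp) => <-. Qed.

Lemma unif_adj1 x y : x \in A :|: L :|: T -> y \in A :|: L :|: T ->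
  adj G x y = adj G1 x y.
Proof.
have sub z : z \in A :|: L :|: T -> z \in vertices G1 :\ c.
  move=> zS; rewrite in_setD1 (comp_V1 hcomp) in_setU zS andbT c_notin //.
  by move: zS; rewrite !inE => /orP[/orP[]|] ->; rewrite ?orbT.
move=> xS yS; have := congr1 (fun K => adj K x y) (unif_1 hG).
by rewrite !adj_induced xS yS !sub // !andbT.
Qed.

Lemma unif_adj2 x y : x \in B :|: C :|: L :|: T -> y \in B :|: C :|: L :|: T ->
  adj G x y = adj G2 x y.
Proof.
have sub z : z \in B :|: C :|: L :|: T -> z \in vertices G2 :\ a.
  move=> zS; rewrite in_setD1 (comp_V2 hcomp) in_setU zS andbT a_notin //.
  by move: zS; rewrite !inE => /orP[/orP[/orP[]|]|] ->; rewrite ?orbT.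
move=> xS yS; have := congr1 (fun K => adj K x y) (unif_2 hG).
by rewrite !adj_induced xS yS !sub // !andbT.
Qed.

(** The pairs [A]-[B] and [A]-[C] are prescribed by the unification itself; [A]-[T], [T]-[T] and
    [L]-[L] are inherited from [G1]; [T]-[C], [L]-[B] and [L]-[C] from [G2]. *)
Lemma compatible_adj p q x y : x \in part_set p -> y \in part_set q ->
  x != y -> compatible p q (adj G x y).
Proof.
have AB u v : u \in A -> v \in B -> adj G u v.
  by move=> uA; case: (unif_AB hG uA) => _; apply.
have AC u v : u \in A -> v \in C -> ~~ adj G u v.
  by move=> uA; case: (unif_AC hG uA) => _; apply.
have AT u v : u \in A -> v \in T -> ~~ adj G u v.
  move=> uA vT; rewrite unif_adj1 ?inE ?uA ?vT ?orbT //.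
  by case: (comp_AT hcomp uA) => _; apply.
have TT u v : u \in T -> v \in T -> ~~ adj G u v.
  by move=> uT vT; rewrite unif_adj1 ?inE ?uT ?vT ?orbT // (comp_T hcomp).
have LL u v : u \in L -> v \in L -> u != v -> adj G u v.
  move=> uL vL; rewrite unif_adj1 ?inE ?uL ?vL ?orbT //.
  exact: (comp_L hcomp).
have TC u v : u \in T -> v \in C -> ~~ adj G u v.
  move=> uT vC; rewrite unif_adj2 ?inE ?uT ?vC ?orbT //.
  by case: (comp_TC hcomp uT) => _; apply.
have LB u v : u \in L -> v \in B -> adj G u v.
  move=> uL vB; rewrite unif_adj2 ?inE ?uL ?vB ?orbT //.
  by case: (comp_LBC hcomp uL) => _; apply; rewrite inE vB.
have LC u v : u \in L -> v \in C -> adj G u v.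
  move=> uL vC; rewrite unif_adj2 ?inE ?uL ?vC ?orbT //.
  by case: (comp_LBC hcomp uL) => _; apply; rewrite inE vC orbT.
by case: p; case: q => //= xp yq xy; first [by auto | by rewrite adjC; auto].
Qed.

(** Thus [c] can stand for a vertex of [B] or [C] with no neighbour in [A] or [T]. *)
Lemma adj_c p x : x \in part_set p -> ~~ inBC p -> adj G1 c x = inL p.
Proof.
have [_ cL] := comp_cL hcomp; have [_ cAT] := comp_cAT hcomp.
case: p => //= xp _; do ?[exact: cL];
  by apply: negbTE; apply: cAT; rewrite inE xp ?orbT.
Qed.

(** Thus [a] can stand for a vertex of [A] with no neighbour in [L]. *)
Lemma adj_a p x :
  x \in part_set p -> ~~ inA p -> adj G2 a x = if p is PB then true else false.
Proof.
have [_ aB] := comp_aB hcomp; have [_ aCLT] := comp_aCLT hcomp.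
case: p => //= xp _; do ?[exact: aB];
  by apply: negbTE; apply: aCLT; rewrite !inE xp ?orbT.
Qed.

Lemma embedding_unification n (H : sgraph 'I_n) (h : rel nat)
    (f : 'I_n -> V) :
    (forall i j : 'I_n, adj H i j = h i j) -> splittable n h ->
    embedding H G f ->
  (exists f1, embedding H G1 f1) \/ (exists f2, embedding H G2 f2).
Proof.
move=> Hh hS fE; have [finj fG fadj] := fE.
pose l i := part_of (f i).
have fl i : f i \in part_set (l i) by apply: part_ofP.
have lS (i j : 'I_n) : i != j -> compatible (l i) (l j) (h i j).
  move=> ij; rewrite -Hh -fadj; apply: compatible_adj => //.
  by rewrite (inj_eq finj).
have fV i : f i \in A :|: B :|: C :|: L :|: T by rewrite -(unif_V hG).
case: (splittableP hS lS) => [] [merged barred]; [left|right].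
- have f1 i : ~~ inBC (l i) -> f i \in A :|: L :|: T.
    by move: (fl i); rewrite !inE; case: (l i) => //= ->; rewrite ?orbT.
  exists (fun i => if inBC (l i) then c else f i).
  apply: (embedding_replace fE) => [|//|i|i j|i j mi mj].
  + by rewrite (comp_V1 hcomp) !inE eqxx orbT.
  + move=> /f1 fi; rewrite (comp_V1 hcomp) in_setU fi.
    by split=> //; apply: c_notin.
  + by move=> /f1 fi /f1 fj; rewrite unif_adj1.
  + have ij : i != j by apply: contraNneq mj => <-.
    (* For [f j] in [L], [compatible] forces the edge; for [f j] in [A] or [T], [barred] excludes
       it. *)
    have := lS i j ij; have := barred i j mi.
    rewrite (adj_c (fl j) mj) Hh; move: mi mj.
    by case: (l i) => //; case: (l j) => //= _ _; case: (h i j) => // /(_ isT).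
- have f2 i : ~~ inA (l i) -> f i \in B :|: C :|: L :|: T.
    by move: (fl i); rewrite !inE; case: (l i) => //= ->; rewrite ?orbT.
  exists (fun i => if inA (l i) then a else f i).
  apply: (embedding_replace fE) => [|//|i|i j|i j mi mj].
  + by rewrite (comp_V2 hcomp) !inE eqxx orbT.
  + move=> /f2 fi; rewrite (comp_V2 hcomp) in_setU fi.
    by split=> //; apply: a_notin.
  + by move=> /f2 fi /f2 fj; rewrite unif_adj2.
  + have ij : i != j by apply: contraNneq mj => <-.
    (* [compatible] forces the edge to [B] and the non-edges to [C] and [T]; [barred] excludes the
       edge to [L]. *)
    have := lS i j ij; have := barred i j mi.
    rewrite (adj_a (fl j) mj) Hh; move: mi mj.
    by case: (l i) => //; case: (l j) => //= _ _; case: (h i j) => // /(_ isT).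
Qed.

(** The order is a successor so that [ord0] can serve as the default in [free_no_embedding]. *)
Lemma free_unification n (H : sgraph 'I_n.+1) (h : rel nat) :
    vertices H = [set: 'I_n.+1] ->
    (forall i j : 'I_n.+1, adj H i j = h i j) -> splittable n.+1 h ->
  free H G1 -> free H G2 -> free H G.
Proof.
move=> HT Hh hS free1 free2; apply: no_embedding_free => // f fE.
case: (embedding_unification Hh hS fE) => [] [g].
  exact: (free_no_embedding ord0 HT free1).
exact: (free_no_embedding ord0 HT free2).
Qed.

End Unification.

(** * The path, its complement and the cycle *)

(** Has the shape produced by [graph_of_adj], but on plain numbers, as the check requires. *)
Definition path_rel : rel nat :=
  fun i j => (i != j) && ((j == i.+1) || (i == j.+1)).

Definition cycle_rel n : rel nat :=
  fun i j => (i != j) && ((j == i.+1 %% n) || (i == j.+1 %% n)).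

Definition complement_rel (r : rel nat) : rel nat :=
  fun i j => (i != j) && ~~ r i j.

Theorem mainTheorem5 (V : finType) (A B C L T : {set V}) (a c : V)
    (G1 G2 G : sgraph V)
    (hcomp : composable A B C L T a c G1 G2)
    (hG : split_graph_unification A B C L T a c G1 G2 G) :
  [/\ free P5 G1 -> free P5 G2 -> free P5 G,
      free (complement P5) G1 -> free (complement P5) G2 ->
        free (complement P5) G
    & free C5 G1 -> free C5 G2 -> free C5 G].
Proof.
have P5E i j : adj P5 i j = path_rel i j by rewrite graph_of_adj.
have coP5E i j : adj (complement P5) i j = complement_rel path_rel i j.
  by rewrite adj_complement !inE P5E.
have C5E i j : adj C5 i j = cycle_rel 5 i j by rewrite graph_of_adj.
split.
(* The computation decides [splittable] over all 5^5 words of parts. *)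
- by apply: (free_unification hcomp hG _ P5E); last by vm_compute.
- by apply: (free_unification hcomp hG _ coP5E); last by vm_compute.
- by apply: (free_unification hcomp hG _ C5E); last by vm_compute.
Qed.
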